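(* Let $r\ge 2$ and let $F$ be an $r$-graph such that $\gamma^+(F)>0$. Then $\gamma^+(F)\ge 1/r$.
   Context: An $r$-graph is a finite $r$-uniform hypergraph. The minimum positive co-degree $\delta_{r-1}^+(H)$ of a non-empty $r$-graph $H$ is the maximum $k$ such that every $(r-1)$-set of vertices contained in some edge of $H$ is contained in at least $k$ distinct edges of $H$; by convention it is $0$ if $H$ has no edges. A hypergraph is $F$-free if it has no (not necessarily induced) subhypergraph isomorphic to $F$. $\mathrm{co^+ex}(n,F)$ is the maximum of $\delta_{r-1}^+(H)$ over all $n$-vertex $F$-free $r$-graphs $H$ (taken to be $0$ if there are none), and $\gamma^+(F)=\lim_{n\to\infty}\mathrm{co^+ex}(n,F)/n$ (this limit exists). *)

(* Defs.v *)
From HB Require Import structures.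
From mathcomp Require Import all_boot all_order all_algebra.
From mathcomp Require Import all_classical all_reals all_analysis.

Set Implicit Arguments.
Unset Strict Implicit.
Unset Printing Implicit Defensive.

Import Order.TTheory GRing.Theory Num.Theory.
Import numFieldNormedType.Exports.

Local Open Scope ring_scope.

Definition r_uniform (r : nat) (V : finType) (E : {set {set V}}) : bool :=
  [forall e in E, #|e| == r].

Record rhypergraph (r : nat) (V : finType) :=
  RHypergraph { edges : {set {set V}} ; _ : r_uniform r edges }.

HB.instance Definition _ (r : nat) (V : finType) :=
  [isSub for @edges r V].
HB.instance Definition _ (r : nat) (V : finType) :=
  [Finite of rhypergraph r V by <:].

Section PositiveCodegree.
Variables (r : nat) (V : finType) (H : rhypergraph r V).

Definition codegree (S : {set V}) : nat :=
  #|[set e in edges H | S \subset e]|.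

Definition codegree_bound (k : nat) : bool :=
  [forall S : {set V},
     (#|S| == r.-1) && [exists e in edges H, S \subset e]
       ==> (k <= codegree S)%N].

(* For r >= 1, cutting the range of k at the number of edges loses nothing:
   a nonempty H has an (r-1)-set inside some edge, and no co-degree exceeds
   the number of edges. *)
Definition min_pos_codegree : nat :=
  if edges H == finset.set0 then 0%N
  else \max_(k < #|edges H|.+1 | codegree_bound k) k.

End PositiveCodegree.

(* The copy of F in H has vertex set f(V(F)) and edge set f(E(F)); it need
   not be induced, and isolated vertices of F must be embedded too. *)
Definition has_copy (r : nat) (T V : finType) (F : rhypergraph r T)
    (H : rhypergraph r V) : bool :=
  [exists f : {ffun T -> V},
     injectiveb f && ([set f @: e | e : {set T} in edges F]%SET \subset edges H)].

Definition copy_free (r : nat) (T V : finType) (F : rhypergraph r T)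
    (H : rhypergraph r V) : bool := ~~ has_copy F H.

(* The maximum over an empty family is 0. *)
Definition coex (r : nat) (T : finType) (F : rhypergraph r T) (n : nat) : nat :=
  \max_(H : rhypergraph r 'I_n | copy_free F H) min_pos_codegree H.

Local Open Scope classical_set_scope.

(* Were the sequence divergent, lim would return its default value 0. *)
Definition gamma_pos (R : realType) (r : nat) (T : finType)
    (F : rhypergraph r T) : R :=
  lim ((fun n : nat => (coex F n)%:R / n%:R : R) @ \oo).

(* Main.v *)
(* Call [F] [r]-partite if its vertices can be coloured with [r] colours so that
   every edge is rainbow.

   If [F] is not [r]-partite, the balanced complete [r]-partite [r]-graph is
   [F]-free and has positive co-degree at least [n %/ r], so the density is at
   least [1 / r].

   If [F] is [r]-partite, the density is [0]: let [H] have positive co-degree at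
   least [n / m].  Starting from an edge and replacing its vertices one at a
   time gives at least [(n / m) ^ r] ordered edges, and by Erdos' theorem such a
   dense [r]-graph contains every fixed complete [r]-partite [r]-graph once [n]
   is large, hence a copy of [F]. *)
Require Import Defs.
From mathcomp Require Import all_boot all_order all_algebra.
From mathcomp Require Import all_classical all_reals all_analysis.
From mathcomp Require Import zify.
Import Order.TTheory GRing.Theory Num.Theory.
Import numFieldNormedType.Exports.

Set Implicit Arguments.
Unset Strict Implicit.

(** * Dense relations contain complete boxes (Erdos) *)

(** Double counting of the related pairs: each [y] in [D] contributes at least [d], which is too
    many if every vertex outside [S] is related to fewer than [#|D| / c] of them. *)
Lemma exists_popular_vertex (V Y : finType) (P : V -> Y -> bool) (D : {set Y})
    (S : {set V}) (d c : nat) :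
    (0 < #|V|)%N -> (#|V| <= c * d)%N ->
    (forall y, y \in D -> d <= #|[set v in ~: S | P v y]|)%N ->
    (0 < #|D|)%N ->
  exists2 v, v \notin S & (#|D| <= c * #|[set y in D | P v y]|)%N.
Proof.
move=> V0 Vd Dd D0.
apply: contrapT => no; have lt v : v \in ~: S -> (c * #|[set y in D | P v y]|).+1 <= #|D|.
  by rewrite inE => vS; rewrite ltnNge; apply/negP => h; apply: no; exists v.
have dc : \sum_(v in ~: S) #|[set y in D | P v y]| = \sum_(y in D) #|[set v in ~: S | P v y]|.
  under eq_bigr do rewrite -sum1dep_card big_mkcondr.
  under [RHS]eq_bigr do rewrite -sum1dep_card big_mkcondr.
  by rewrite exchange_big.
have h1 : #|D| * d <= \sum_(v in ~: S) #|[set y in D | P v y]|.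
  by rewrite dc -sum_nat_const leq_sum.
have h2 : \sum_(v in ~: S) (c * #|[set y in D | P v y]|).+1 <= #|V| * #|D|.
  apply: (@leq_trans (\sum_(v in ~: S) #|D|)); first exact: leq_sum.
  rewrite sum_nat_const leq_mul2r.
  by rewrite max_card orbT.
(* If no vertex lies outside [S], then [d = 0], which forces [V] to be empty. Otherwise the strict
   inequalities summed over [~: S] contradict [h1]. *)
have [SV|SV] := posnP #|~: S|.
  have /card_gt0P[y yD] := D0.
  have := Dd _ yD; rewrite (eqP (_ : #|_| == 0)) ?leqn0.
    by move=> /eqP d0; move: Vd V0; rewrite d0; lia.
  by rewrite -leqn0 -SV; apply/subset_leq_card/fintype.subsetP => v; rewrite inE => /andP[].
have : \sum_(v in ~: S) (c * #|[set y in D | P v y]|).+1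
   = c * (\sum_(v in ~: S) #|[set y in D | P v y]|) + #|~: S|.
  by under eq_bigr do rewrite -addn1; rewrite big_split /= sum1_card big_distrr.
nia.
Qed.

(* Add popular vertices to [S] one at a time, keeping a fraction [1 / c] of [D]
   at each step. *)
Lemma exists_common_neighbourhood (V Y : finType) (P : V -> Y -> bool)
    (D : {set Y}) (t d c : nat) :
    (0 < #|V|)%N -> (#|V| <= c * d)%N -> (0 < #|D|)%N ->
    (forall y, y \in D -> d + t <= #|[set v | P v y]|)%N ->
  exists2 S : {set V}, #|S| = t &
    (#|D| <= c ^ t * #|[set y in D | [forall v in S, P v y]]|)%N.
Proof.
move=> V0 Vd D0 Dd.
suff H s : s <= t -> exists2 S : {set V}, #|S| = s &
    (#|D| <= c ^ s * #|[set y in D | [forall v in S, P v y]]|)%N by exact: H.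
elim: s => [_|s IH st].
  exists finset.set0; rewrite ?cards0// expn0 mul1n; apply/subset_leq_card/fintype.subsetP => y yD.
  by rewrite inE yD; apply/forall_inP => v; rewrite inE.
have [S Ss DS] := IH (ltnW st).
set D' := [set y in D | _] in DS.
have [||v vS vD] := @exists_popular_vertex V Y P D' S d c V0 Vd.
- move=> y; rewrite inE => /andP[yD _].
  have := Dd _ yD; set A := [set v | _]; set B := [set v in ~: S | _].
  (* Discarding [S] costs fewer than [t] neighbours, which the slack in [d + t] absorbs. *)
  have : #|A| <= #|S| + #|B|.
    apply: (leq_trans _ (leq_card_setU S B)); apply/subset_leq_card/fintype.subsetP => v.
    by rewrite !inE => ->; rewrite andbT orbN.
  lia.
- by rewrite lt0n; apply: contraTneq D0 => D'0; move: DS; rewrite D'0 muln0 -ltnNge.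
exists (v |: S); first by rewrite cardsU1 vS Ss.
apply: (leq_trans DS); rewrite expnSr -mulnA leq_mul2l; apply/orP; right.
apply: (leq_trans vD); rewrite leq_mul2l; apply/orP; right.
apply/subset_leq_card/fintype.subsetP => y; rewrite !inE => /andP[/andP[-> /forall_inP h] Py] /=.
by apply/forall_inP => w; rewrite !inE => /orP[/eqP->//|/h].
Qed.

(** The Kovari-Sos-Turan step; the fraction of [Y] that survives depends only on [m] and [t], so it
    can be iterated. *)
Lemma dense_bipartite_common_nbh (V Y : finType) (P : V -> Y -> bool) (m t : nat) :
    (4 * m * t.+1 <= #|V|)%N -> 0 < m -> 0 < #|Y| ->
    (#|V| * #|Y| <= m * \sum_v #|[set y | P v y]|)%N ->
  exists2 S : {set V}, #|S| = t &
    (#|Y| <= 2 * m * (4 * m) ^ t * #|[set y | [forall v in S, P v y]]|)%N.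
Proof.
move=> Vt m0 Y0 dens; have V0 : 0 < #|V| by nia.
(* By averaging, a fraction [1 / (2m)] of [Y] has degree above [#|V| / (2m)]. *)
pose D := [set y | #|V| < 2 * m * #|[set v | P v y]|].
have dc : \sum_v #|[set y | P v y]| = \sum_y #|[set v | P v y]|.
  under eq_bigr do rewrite -sum1dep_card big_mkcond.
  under [RHS]eq_bigr do rewrite -sum1dep_card big_mkcond.
  by rewrite exchange_big.
have YD : #|Y| <= 2 * m * #|D|.
  have ub : 2 * m * \sum_y #|[set v | P v y]| <= #|V| * #|Y| + 2 * m * #|V| * #|D|.
    rewrite big_distrr /= (bigID (mem D)) /= addnC; apply: leq_add.
      apply: (@leq_trans (\sum_(y | y \notin D) #|V|)).
        by apply: leq_sum => y; rewrite inE -leqNgt.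
      by rewrite sum_nat_const mulnC leq_mul2l max_card orbT.
    rewrite [leqRHS]mulnC -sum_nat_const; apply: leq_sum => y _.
    by rewrite leq_mul2l max_card orbT.
  rewrite -(leq_pmul2l V0); move: ub dens; rewrite dc; nia.
have D0 : 0 < #|D| by nia.
(* With [q = #|V| %/ (4 * m)], degrees on [D] exceed [2 * q], and [t < q], so they are at least
   [q.+1 + t]; the successor makes up for rounding down. *)
have [||S St DS] := @exists_common_neighbourhood V Y P D t (#|V| %/ (4 * m)).+1 (4 * m) V0 _ D0.
- by have := ltn_ceil #|V| (_ : 0 < 4 * m); lia.
- move=> y; rewrite inE => hy; have := leq_trunc_div #|V| (4 * m).
  set q := _ %/ _ => hq.
  have : t.+1 <= q by rewrite leq_divRL; lia.
  by move=> tq; nia.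
exists S => //; apply: (leq_trans YD); rewrite -[leqRHS]mulnA leq_mul2l; apply/orP; right.
apply: (leq_trans DS); rewrite leq_mul2l; apply/orP; right.
by apply/subset_leq_card/fintype.subsetP => y; rewrite !inE => /andP[].
Qed.

Lemma card_tuple_cons (V : finType) (r : nat) (P : pred (seq V)) :
  #|[set x : r.+1.-tuple V | P x]| = \sum_v #|[set y : r.-tuple V | P (v :: y)]|.
Proof.
under eq_bigr do rewrite -sum1dep_card.
rewrite -sum1dep_card pair_big_dep /=.
rewrite (reindex (fun p : V * r.-tuple V => [tuple of p.1 :: p.2])) //=.
exists (fun x => (thead x, [tuple of behead x])) => [[v y] _|x _] /=.
  by congr pair; apply/val_inj.
by rewrite -tuple_eta.
Qed.

(** Induction on [r], splitting off the first coordinate: some [t]-set [S] has a positive fraction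
    of the shorter tuples completed by all its members. Those tuples form the predicate [Q], which
    is why [P] is arbitrary rather than an edge relation. *)
Lemma dense_contains_box (r t m : nat) : 0 < m ->
  exists N, forall (V : finType) (P : pred (seq V)),
    N <= #|V| -> #|V| ^ r <= m * #|[set x : r.-tuple V | P x]| ->
  exists As : seq {set V}, [/\ size As = r, all (fun A : {set V} => #|A| == t) As &
    forall s, all2 (fun v (A : {set V}) => v \in A) s As -> P s].
Proof.
elim: r m => [|r IH] m m0.
  exists 0 => V P _; rewrite expn0 => h; exists [::]; split=> // -[|//] _.
  have /card_gt0P[x] : 0 < #|[set x : 0.-tuple V | P x]| by lia.
  by rewrite tuple0 inE.
have m'0 : 0 < 2 * m * (4 * m) ^ t by rewrite !muln_gt0 m0 expn_gt0 muln_gt0 m0.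
have [N HN] := IH _ m'0.
exists (maxn N (4 * m * t.+1)) => V P; rewrite geq_max => /andP[NV tV].
rewrite card_tuple_cons expnS -card_tuple => dens.
have Y0 : 0 < #|{: r.-tuple V}| by rewrite card_tuple expn_gt0; nia.
have [S St SY] := dense_bipartite_common_nbh tV m0 Y0 dens.
pose Q s := [forall v in S, P (v :: s)].
rewrite card_tuple in SY.
have [As [sA cA HA]] := HN V Q NV SY.
exists (S :: As); split; rewrite /= ?sA ?St ?eqxx//.
move=> [//|v s] /= /andP[vS /HA /forall_inP]; exact.
Qed.

(** * Positive co-degree forces many ordered edges *)

Section HostGraph.
Variables (r : nat) (V : finType) (H : rhypergraph r V).

Lemma edge_card e : e \in edges H -> #|e| = r.
Proof. by case: H => E /= /forall_inP h /h/eqP. Qed.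

Lemma codegree_le_extensions (S : {set V}) : 0 < r -> #|S| = r.-1 ->
  codegree H S <= #|[set v | v |: S \in edges H]|.
Proof.
move=> r0 Sr; apply: (leq_trans _ (leq_imset_card (fun v => v |: S) _)).
apply/subset_leq_card/fintype.subsetP => e; rewrite inE => /andP[eH Se].
have /cards1P[v ev] : #|e :\: S| == 1%N.
  by rewrite cardsD (finset.setIidPr Se) (edge_card eH) Sr; apply/eqP; lia.
have eE : e = v |: S by rewrite -[LHS](finset.setID e S) ev (finset.setIidPr Se) finset.setUC.
by apply/imsetP; exists v; rewrite ?inE -?eE.
Qed.

(** Here [e] holds the vertices of the edge still to be replaced and [u] those kept fixed. Dropping
    the head of [e] leaves an [(r-1)]-set with at least [k] extensions [v]; each [v] joins [u]. *)
Lemma count_edge_tuples (k l : nat) (e u : seq V) : codegree_bound H k ->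
    size e = l -> size (e ++ u) = r -> [set x in e ++ u] \in edges H ->
  k ^ l <= #|[set s : l.-tuple V | [set x in s ++ u] \in edges H]|.
Proof.
move=> Hk; elim: l e u => [|l IH] [|x e] u //= => [_ _ uH|[el] sr xH].
  by rewrite expn0; apply/card_gt0P; exists [tuple]; rewrite inE.
have : uniq (x :: e ++ u).
  by apply/card_uniqP; rewrite -cardsE /= sr (edge_card xH).
move=> /= /andP[_ /card_uniqP]; rewrite -cardsE => cS.
rewrite (card_tuple_cons _ (fun s => [set x in s ++ u] \in edges H)) /=.
pose G := [set v | v |: [set x in e ++ u] \in edges H].
have Gk : k <= #|G|.
  apply: leq_trans (codegree_le_extensions _ _); [|by rewrite -sr..|by rewrite cS -sr].
  have /forallP/(_ [set x in e ++ u])/implyP := Hk; apply.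
  apply/andP; split; first by rewrite cS -sr.
  apply/exists_inP; exists [set z in x :: e ++ u] => //.
  by apply/fintype.subsetP => y; rewrite !inE => ->; rewrite orbT.
rewrite expnS; apply: (@leq_trans (\sum_(v in G) k ^ l)).
  by rewrite sum_nat_const leq_mul2r Gk orbT.
apply: (@leq_trans (\sum_(v in G) #|[set y : l.-tuple V | [set x in (v :: y) ++ u] \in edges H]|)).
  apply: leq_sum => v; rewrite inE => vG.
  have perm (y : l.-tuple V) : [set x in (v :: y) ++ u] = [set x in y ++ v :: u].
    by apply/setP => z; rewrite !inE !mem_cat !inE orbCA.
  have -> : [set y : l.-tuple V | [set x in (v :: y) ++ u] \in edges H]
      = [set y : l.-tuple V | [set x in y ++ v :: u] \in edges H].
    by apply/setP => y; rewrite inE [RHS]inE perm.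
  apply: (IH e) => //; first by rewrite -sr !size_cat /= addnS.
  suff -> : [set x in e ++ v :: u] = v |: [set x in e ++ u] by [].
  by apply/setP => z; rewrite !inE !mem_cat !inE orbCA.
by rewrite [leqRHS](bigID (mem G)) /= leq_addr.
Qed.

End HostGraph.

Lemma set_map_enum (I V : finType) (f : I -> V) :
  [set x in [seq f i | i <- enum I]] = [set f i | i : I].
Proof.
by apply/setP => x; rewrite inE; apply/mapP/imsetP => -[i iI ->]; exists i; rewrite ?mem_enum.
Qed.

Lemma dense_contains_blowup (r t m : nat) : 0 < r -> 0 < m ->
  exists N, forall (V : finType) (H : rhypergraph r V) (k : nat),
    N <= #|V| -> edges H != finset.set0 -> codegree_bound H k -> #|V| <= m * k ->
  exists A : 'I_r -> {set V}, (forall i, #|A i| = t) /\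
    forall x : 'I_r -> V, (forall i, x i \in A i) -> [set x i | i : 'I_r] \in edges H.
Proof.
move=> r0 m0; have mr0 : 0 < m ^ r by rewrite expn_gt0 m0.
have [N HN] := dense_contains_box r t mr0.
exists N => V H k NV /set0Pn[e eH] Hk Vk.
have [|As [sA cA HA]] := HN V (fun s => [set x in s] \in edges H) NV.
  apply: (@leq_trans ((m * k) ^ r)); first by rewrite leq_exp2r.
  rewrite expnMn leq_mul2l; apply/orP; right.
  (* Replacing a whole edge gives [k ^ r] ordered edges, hence density at least [1 / m ^ r]. *)
  have := @count_edge_tuples r V H k r (enum e) [::] Hk.
  rewrite cats0 -cardE set_enum (edge_card eH) => /(_ erefl erefl eH) h.
  by apply: (leq_trans h); apply/subset_leq_card/fintype.subsetP => s; rewrite !inE cats0.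
exists (fun i => nth finset.set0 As i); split=> [i|x xA].
  by apply/eqP; have /all_nthP := cA; apply; rewrite sA.
rewrite -set_map_enum; apply: HA.
rewrite all2E size_map -cardE card_ord sA eqxx /=.
apply/(all_nthP (x (Ordinal r0), finset.set0)) => i.
rewrite size_zip size_map -cardE card_ord sA minnn => ir.
rewrite nth_zip; last by rewrite size_map size_enum_ord sA.
rewrite (nth_map (Ordinal r0)) ?size_enum_ord//=.
by rewrite -[i]/(val (Ordinal ir)) nth_ord_enum.
Qed.

(** * Embedding [r]-partite hypergraphs in blow-ups *)

Definition r_partite (r : nat) (T : finType) (F : rhypergraph r T) : Prop :=
  exists c : T -> 'I_r, forall e, e \in edges F -> {in e &, injective c}.

Lemma blowup_has_copy (r : nat) (T V : finType) (F : rhypergraph r T)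
    (H : rhypergraph r V) (A : 'I_r -> {set V}) :
    r_partite F -> (forall i, #|A i| = #|T|) ->
    (forall x : 'I_r -> V, (forall i, x i \in A i) -> [set x i | i : 'I_r] \in edges H) ->
  has_copy F H.
Proof.
move=> [c cF] At HA.
have aP v : #|T| = #|A (c v)| by rewrite At.
(* The vertex [v] goes to the element of part [c v] whose index is the rank of [v] in [T], so
   vertices of the same colour stay distinct. *)
pose f v : V := enum_val (cast_ord (aP v) (enum_rank v)).
have fA v : f v \in A (c v) by exact: enum_valP.
have pick (u : T) i : {w | w \in A i}.
  have : 0 < #|A i| by rewrite At; apply/card_gt0P; exists u.
  by move=> /card_gt0P/sigW.
(* A vertex in two parts would give an edge with fewer than [r] vertices. *)
have disj i j x : x \in A i -> x \in A j -> i = j.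
  move=> xi xj; apply/eqP; apply: contraT => ij.
  have [u _] : exists u : T, u \in T.
    by apply/card_gt0P; rewrite -(At i); apply/card_gt0P; exists x.
  pose y k := if (k == i) || (k == j) then x else sval (pick u k).
  have /HA/edge_card/esym : forall k, y k \in A k.
    move=> k; rewrite /y; case: eqP => [->//|_]; case: eqP => [->//|_] /=.
    exact: (svalP (pick u k)).
  rewrite -{1}[r]card_ord => /esym/eqP/imset_injP /(_ i j erefl erefl) yij.
  by move: ij; rewrite yij ?eqxx// /y !eqxx orbT.
apply/existsP; exists [ffun v => f v]; apply/andP; split.
  apply/injectiveP => u v; rewrite !ffunE => fuv.
  have cuv : c u = c v by apply: (disj _ _ (f u)) => //; rewrite fuv.
  apply: enum_rank_inj; apply: val_inj.
  have fE w : f w = nth (f u) (enum (A (c w))) (enum_rank w) by exact: enum_val_nth.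
  move: fuv => /eqP; rewrite (fE u) (fE v) -cuv.
  by rewrite nth_uniq ?enum_uniq -?cardE ?At ?ltn_ord// => /eqP.
apply/fintype.subsetP => _ /imsetP[e eF ->].
(* A rainbow edge has [r] vertices and so meets every colour; its image is therefore a transversal
   of the parts. *)
have ce i : exists2 v, v \in e & c v = i.
  have : i \in [set c v | v in e].
    suff -> : [set c v | v in e] = [set: 'I_r] by rewrite inE.
    apply/eqP; rewrite eqEcard finset.subsetT cardsT card_ord.
    by rewrite card_in_imset ?(edge_card eF) ?leqnn//; exact: cF.
  by move=> /imsetP[v ve ->]; exists v.
pose g i := s2val (cid2 (ce i)).
have ge i : g i \in e by rewrite /g; case: cid2.
have gc i : c (g i) = i by rewrite /g; case: cid2.
suff -> : [set [ffun v => f v] v | v in e] = [set f (g i) | i : 'I_r].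
  by apply: HA => i; rewrite -{2}(gc i).
apply/setP => x; apply/imsetP/imsetP => [[v ve]|[i _]] ->.
  by exists (c v) => //; rewrite ffunE; congr f; apply: (cF e eF).
by exists (g i); rewrite ?ffunE.
Qed.

(** * Co-degree bounds and the [r]-partite case *)

Lemma leq_min_pos_codegree (r : nat) (V : finType) (H : rhypergraph r V) (k : nat) :
  0 < r -> edges H != finset.set0 -> codegree_bound H k -> k <= min_pos_codegree H.
Proof.
move=> r0 H0 Hk; rewrite /min_pos_codegree (negbTE H0).
have kE : k < #|edges H|.+1.
  have /set0Pn[e eH] := H0.
  have /card_gt0P[x xe] : 0 < #|e| by rewrite (edge_card eH).
  have /forallP/(_ (e :\ x))/implyP/(_ _)/leq_trans := Hk; apply.
    apply/andP; split; first by rewrite -(edge_card eH) (cardsD1 x e) xe.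
    by apply/exists_inP; exists e => //; apply: subD1set.
  by apply/subset_leq_card/fintype.subsetP => ?; rewrite inE => /andP[].
exact: (@leq_bigmax_cond _ _ _ (Ordinal kE)).
Qed.

Lemma min_pos_codegree_leP (r : nat) (V : finType) (H : rhypergraph r V) (K : nat) :
  (edges H != finset.set0 -> forall k, codegree_bound H k -> k <= K) ->
  min_pos_codegree H <= K.
Proof.
rewrite /min_pos_codegree; case: ifP => // _ h.
by apply/bigmax_leqP => k; exact: h.
Qed.

(** A host with co-degree above [n / m] would contain a blow-up with parts of size [#|T|], hence
    [F]. As [m] is arbitrary, the density vanishes. *)
Lemma coex_r_partite (r : nat) (T : finType) (F : rhypergraph r T) (m : nat) :
  0 < r -> r_partite F -> 0 < m -> exists N, forall n, N <= n -> m * coex F n <= n.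
Proof.
move=> r0 Fr m0; have [N HN] := dense_contains_blowup #|T| r0 m0.
exists N => n Nn; rewrite mulnC -leq_divRL//; apply/bigmax_leqP => H Hfree.
apply: min_pos_codegree_leP => H0 k Hk; rewrite leqNgt; apply/negP => kn.
have [||A [At HA]] := HN _ H k _ H0 Hk; rewrite ?card_ord//.
  by rewrite ltnW// mulnC -ltn_divLR.
by move: Hfree; rewrite /copy_free (blowup_has_copy Fr At HA).
Qed.

(** * The balanced complete [r]-partite hypergraph, with residue classes modulo [r] as parts *)

Section CompletePartite.
Variables (r n : nat) (r0 : 0 < r).

Definition residue (i : 'I_n) : 'I_r := Ordinal (ltn_pmod i r0).

Definition rainbow_edges : {set {set 'I_n}} :=
  [set e : {set 'I_n} | (#|e| == r) && (#|[set residue i | i in e]| == r)].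

Fact rainbow_edges_uniform : r_uniform r rainbow_edges.
Proof. by apply/forall_inP => e; rewrite inE => /andP[]. Qed.

Definition complete_partite : rhypergraph r 'I_n := RHypergraph rainbow_edges_uniform.

(** A copy of [F] would pull the residues back to an [r]-colouring with rainbow edges. *)
Lemma complete_partite_free (T : finType) (F : rhypergraph r T) :
  ~ r_partite F -> copy_free F complete_partite.
Proof.
move=> Fr; apply/negP => /existsP[f /andP[/injectiveP fI /fintype.subsetP fE]].
apply: Fr; exists (residue \o f) => e eF; apply/imset_injP.
have := fE _ (imset_f _ eF); rewrite inE => /andP[_].
by rewrite -imset_comp (edge_card eF).
Qed.

Lemma card_residue_class (j : 'I_r) : n %/ r <= #|[set i | residue i == j]|.
Proof.
(* The numbers [q * r + j] with [q < n %/ r] are distinct members of the class of [j]. *)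
have lt (q : 'I_(n %/ r)) : q * r + j < n.
  by have := leq_trunc_div n r; have := ltn_ord q; have := ltn_ord j; nia.
rewrite -[leqLHS]card_ord -(card_imset predT (_ : injective (fun q => Ordinal (lt q)))).
  apply/subset_leq_card/fintype.subsetP => _ /imsetP[q _ ->]; rewrite inE.
  by apply/eqP/val_inj; rewrite /= modnMDl modn_small.
move=> q q' [] /eqP; rewrite eqn_add2r eqn_pmul2r// => /eqP; exact: val_inj.
Qed.

Lemma complete_partite_codegree : codegree_bound complete_partite (n %/ r).
Proof.
apply/forallP => S; apply/implyP => /andP[/eqP Sr /exists_inP[e]].
rewrite inE => /andP[/eqP er /eqP ec] Se.
have cI : {in e &, injective residue} by apply/imset_injP; rewrite er ec.
have cS : #|[set residue i | i in S]| = r.-1.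
  by rewrite card_in_imset// => i j /(fintype.subsetP Se) ie /(fintype.subsetP Se); exact: cI.
(* An [(r-1)]-set inside an edge misses a residue [j], and adding any vertex of class [j] gives an
   edge. *)
have [j jS] : exists j, j \notin [set residue i | i in S].
  apply/existsP; rewrite -negb_forall; apply/negP => /forallP h.
  have := max_card (mem [set residue i | i in S]); rewrite card_ord.
  suff : [set residue i | i in S] = [set: 'I_r] by move=> E; move: cS; rewrite E cardsT card_ord; lia.
  by apply/setP => i; rewrite h inE.
have notS v : residue v = j -> v \notin S.
  by move=> vj; apply: contra jS => vS; rewrite -vj imset_f.
apply: (leq_trans (card_residue_class j)).
rewrite -(@card_in_imset _ _ (fun v => v |: S)).
  apply/subset_leq_card/fintype.subsetP => x /imsetP[v]; rewrite inE => /eqP vj ->.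
  rewrite inE finset.subsetUr andbT inE imsetU1 !cardsU1 notS// vj jS Sr cS.
  by rewrite add1n prednK// eqxx.
move=> u v; rewrite !inE => /eqP uj /eqP vj /setP/(_ u).
have uS := notS _ uj.
by rewrite !inE eqxx (negbTE uS) !orbF => /esym/eqP.
Qed.

Lemma complete_partite_nonempty : r <= n -> edges complete_partite != finset.set0.
Proof.
move=> rn; apply/set0Pn; exists [set widen_ord rn i | i : 'I_r].
have wI : injective (widen_ord rn) by move=> i j [] /val_inj.
rewrite inE card_imset// card_ord eqxx -imset_comp card_imset ?card_ord ?eqxx//.
by move=> i j [] /eqP; rewrite !modn_small// => /eqP/val_inj.
Qed.

End CompletePartite.

Lemma coex_not_r_partite (r : nat) (T : finType) (F : rhypergraph r T) (n : nat) :
  0 < r -> ~ r_partite F -> r <= n -> n %/ r <= coex F n.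
Proof.
move=> r0 Fr rn.
apply: leq_trans (leq_bigmax_cond _ (complete_partite_free n r0 Fr)).
apply: leq_min_pos_codegree => //; first exact: complete_partite_nonempty.
exact: complete_partite_codegree.
Qed.

Local Open Scope ring_scope.

(** * Passage to the limit *)

Lemma le_of_sub_inv_nat (R : realType) (a b : R) :
  (forall m, (0 < m)%N -> a - m%:R^-1 <= b) -> a <= b.
Proof.
move=> h; apply/ler_addgt0Pr => e e0.
have := truncnS_gt e^-1; set m := Num.trunc _ => em.
have := h m.+1 erefl; rewrite lerBlDr => /le_trans; apply.
by rewrite lerD2l invf_ple ?posrE// ltW.
Qed.

Theorem corollary27 (R : realType) (r : nat) (hr : (2 <= r)%N)
    (T : finType) (F : rhypergraph r T) :
  0 < gamma_pos R F -> 1 / r%:R <= gamma_pos R F.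
Proof.
move=> g0; have r0 : (0 < r)%N by lia.
set u := fun n : nat => (coex F n)%:R / n%:R : R.
(* The limit of a divergent sequence is the default value [0]. *)
have ucvg : (cvg (u @ \oo))%classic.
  by apply: contrapT => /dvgP u0; move: g0; rewrite /gamma_pos u0 ltxx.
have [Fr|Fr] := pselect (r_partite F).
  suff : gamma_pos R F <= 0 by rewrite leNgt g0.
  apply: le_of_sub_inv_nat => m m0; rewrite lerBlDr add0r.
  have [N HN] := coex_r_partite r0 Fr m0.
  (* The bound [1] keeps the denominator [n] nonzero. *)
  apply: limr_le => //; exists (maxn N 1) => // n /=; rewrite geq_max => /andP[Nn n0].
  rewrite /u ler_pdivrMr ?ltr0n// mulrC ler_pdivlMr ?ltr0n//.
  by rewrite -natrM ler_nat mulnC HN.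
apply: le_of_sub_inv_nat => m m0.
(* [r <= n] makes the complete [r]-partite host nonempty, and [m <= n] lets the rounding error
   [1 / n] be absorbed by [1 / m]. *)
apply: limr_ge => //; exists (maxn r m) => // n /=; rewrite geq_max => /andP[rn mn].
have n0 : (0 < n)%N by lia.
apply: (@le_trans _ _ ((n %/ r)%:R / n%:R)); last first.
  by rewrite ler_wpM2r ?invr_ge0// ler_nat coex_not_r_partite.
apply: (@le_trans _ _ (1 / r%:R - n%:R^-1)).
  by rewrite lerD2l lerN2 lef_pV2 ?posrE ?ltr0n// ler_nat.
rewrite ler_pdivlMr ?ltr0n// mulrBl mulVf ?pnatr_eq0 -?lt0n//.
rewrite lerBlDr mulrAC mul1r ler_pdivrMr ?ltr0n// natr1 -natrM ler_nat.
by rewrite ltnW// ltn_ceil.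
Qed.
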